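(* Let $A \in \mathbb{R}^{m\times n}$ have rows $\mathbf{a}_1^\top,\dots,\mathbf{a}_m^\top$, normalized so that $\|\mathbf{a}_i\| = 1$ for all $i=1,\dots,m$. Suppose the system of equations $A\mathbf{x}=\mathbf{b}$ is consistent, define $\mathbf{x}^* = A^\dagger \mathbf{b}$, and let $\mathbf{x}_0 \in \mathrm{range}(A^\top)$. Then the Sampling Kaczmarz-Motzkin (SKM) method with sample size $\beta$, started at $\mathbf{x}_0$, converges at least linearly in expectation, and the bound on the rate depends on the dynamic range $\gamma_k$ of the random sample $\tau_k$ of $\beta$ rows of $A$. Precisely, in the $k$th iteration of SKM, $$\mathbb{E}_{\tau_k} \|\mathbf{x}_k - \mathbf{x}^*\|^2 \le \left(1 - \frac{\beta\, \sigma_{\min}^2(A)}{\gamma_k\, m}\right) \|\mathbf{x}_{k-1} - \mathbf{x}^*\|^2 ,$$ so, applying expectation with respect to all iterations, $$\mathbb{E} \|\mathbf{x}_k - \mathbf{x}^*\|^2 \le \prod_{j=1}^k \left(1 - \frac{\beta\, \sigma_{\min}^2(A)}{\gamma_j\, m}\right) \|\mathbf{x}_0 - \mathbf{x}^*\|^2 .$$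
   Context: Standing assumption: $m>n$; no assumption is made on $\mathrm{rank}(A)$. $\|\cdot\|$ is the Euclidean norm, $\|\cdot\|_\infty$ the $\ell^\infty$ norm, $A^\dagger$ the Moore-Penrose pseudoinverse, and $\sigma_{\min}(A)$ the smallest nonzero singular value of $A$. $[m]=\{1,\dots,m\}$, $\beta\in[m]$, and $\binom{[m]}{\beta}$ is the set of subsets of $[m]$ of size $\beta$. For $\tau\subseteq[m]$, $A_\tau$ and $\mathbf{b}_\tau$ are the restrictions of $A$ and $\mathbf{b}$ to the rows indexed by $\tau$. SKM with sample size $\beta$: in iteration $k\ge 1$, sample $\tau_k$ uniformly at random from $\binom{[m]}{\beta}$, choose $t_k = \arg\max_{i\in\tau_k} |\mathbf{a}_i^\top \mathbf{x}_{k-1} - b_i|$ (ties broken arbitrarily), and set $$\mathbf{x}_k = \mathbf{x}_{k-1} - \frac{\mathbf{a}_{t_k}^\top \mathbf{x}_{k-1} - b_{t_k}}{\|\mathbf{a}_{t_k}\|^2}\,\mathbf{a}_{t_k}.$$ Dynamic range at iteration $j$: $$\gamma_j = \frac{\sum_{\tau \in \binom{[m]}{\beta}} \|A_{\tau}\mathbf{x}_{j-1} - \mathbf{b}_{\tau}\|^2}{\sum_{\tau \in \binom{[m]}{\beta}} \|A_{\tau}\mathbf{x}_{j-1} - \mathbf{b}_{\tau}\|_\infty^2}$$ (this quotient is meaningful when $A\mathbf{x}_{j-1}\neq \mathbf{b}$). $\mathbb{E}_{\tau_k}$ is expectation with respect to the random sample $\tau_k$, conditioned on the previously sampled $\tau_i$,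 $i<k$. $\mathbb{E}$ is expectation with respect to all random samples $\tau_i$, $1\le i\le k$, where $k$ is the last iteration in the context in which $\mathbb{E}$ is applied.
   Formalization: In the last inequality the product depends on the random samples through γ_j, and it fails both for every realization and with an expectation around the product; the formal bound uses the largest value of the product over realizations along which all γ_j are defined. *)

(* Defs.v *)
From mathcomp Require Import all_boot all_order all_algebra.
From mathcomp Require Import boolp classical_sets reals matrix_normedtype.

Set Implicit Arguments.
Unset Strict Implicit.
Unset Printing Implicit Defensive.

Import Order.TTheory GRing.Theory Num.Theory.
Local Open Scope ring_scope.

(* Euclidean norm. The l^oo norm is the library's [mx_norm] (largest absolute
   value of an entry). *)
Definition norm2 (R : realType) (p : nat) (v : 'cV[R]_p) : R :=
  Num.sqrt (\sum_i v i 0 ^+ 2).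

(* The four Penrose conditions. *)
Definition is_pinv (R : realType) (m n : nat) (A : 'M[R]_(m, n))
    (X : 'M[R]_(n, m)) : Prop :=
  [/\ A *m X *m A = A, X *m A *m X = X,
      (A *m X)^T = A *m X & (X *m A)^T = X *m A].

(* Moore-Penrose pseudoinverse: [pinvP] and [is_pinv_uniq] below show that it
   is the unique matrix satisfying the Penrose conditions (the library's
   [pinvmx] is a different generalized inverse). *)
Definition pinv (R : realType) (m n : nat) (A : 'M[R]_(m, n)) : 'M[R]_(n, m) :=
  xget 0 [set X | is_pinv A X]%classic.

(* Singular values: nonnegative square roots of the eigenvalues of A^T A. *)
Definition singular_value (R : realType) (m n : nat) (A : 'M[R]_(m, n))
    (s : R) : Prop :=
  0 <= s /\ eigenvalue (A^T *m A) (s ^+ 2).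

(* Smallest nonzero singular value; the set is finite, so the infimum is a
   minimum as soon as A != 0. *)
Definition sigma_min (R : realType) (m n : nat) (A : 'M[R]_(m, n)) : R :=
  inf [set s | singular_value A s /\ s != 0]%classic.

Definition row_restrict (R : realType) (m p : nat) (tau : {set 'I_m})
    (A : 'M[R]_(m, p)) : 'M[R]_(#|tau|, p) :=
  rowsub (@enum_val _ (mem tau)) A.

Definition samples (m beta : nat) : {set {set 'I_m}} :=
  [set tau : {set 'I_m} | #|tau| == beta]%SET.

(* Histories list the successive samples with the MOST RECENT ONE FIRST: after
   k iterations the history is [:: tau_k; ...; tau_1]. *)
Definition histories (m beta k : nat) : {set k.-tuple {set 'I_m}} :=
  [set h : k.-tuple {set 'I_m} | all (mem (samples m beta)) h]%SET.

(* The history [:: tau_j; ...; tau_1] after the first j iterations of h. *)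
Definition past (T : Type) (h : seq T) (j : nat) : seq T :=
  drop (size h - j) h.

(* Expectation under the uniform distribution on S. On [histories m beta k]
   this makes tau_1, ..., tau_k independent and uniform on [samples m beta]. *)
Definition mean (R : realType) (T : finType) (S : {set T}) (f : T -> R) : R :=
  (\sum_(s in S) f s) / #|S|%:R.

(* The iterate x_k reached after the history h = [:: tau_k; ...; tau_1]; the
   row used at each iteration is t_k = t tau_k [:: tau_(k-1); ...; tau_1]. *)
Fixpoint skm (R : realType) (m n : nat) (A : 'M[R]_(m, n)) (b : 'cV[R]_m)
    (x0 : 'cV[R]_n) (t : {set 'I_m} -> seq {set 'I_m} -> 'I_m)
    (h : seq {set 'I_m}) : 'cV[R]_n :=
  if h is tau :: h' then
    let x := skm A b x0 t h' in
    let a := (row (t tau h') A)^T in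
    x - ((A *m x - b) (t tau h') 0 / norm2 a ^+ 2) *: a
  else x0.

(* t_k is a maximizer over tau_k of |a_i^T x_(k-1) - b_i|. Ties are broken by
   an arbitrary rule, which may depend on the whole past. *)
Definition skm_selection (R : realType) (m n beta : nat) (A : 'M[R]_(m, n))
    (b : 'cV[R]_m) (x0 : 'cV[R]_n)
    (t : {set 'I_m} -> seq {set 'I_m} -> 'I_m) : Prop :=
  forall (tau : {set 'I_m}) (h : seq {set 'I_m}),
    tau \in samples m beta -> all (mem (samples m beta)) h ->
    let res := A *m skm A b x0 t h - b in
    t tau h \in tau /\
    forall i, i \in tau -> `|res i 0| <= `|res (t tau h) 0|.

(* The dynamic range gamma_j is [dyn_range beta A b x_(j-1)]; it is meaningful
   only when A x_(j-1) != b. *)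
Definition dyn_range (R : realType) (m n beta : nat) (A : 'M[R]_(m, n))
    (b : 'cV[R]_m) (x : 'cV[R]_n) : R :=
  (\sum_(tau in samples m beta)
      norm2 (row_restrict tau A *m x - row_restrict tau b) ^+ 2) /
  (\sum_(tau in samples m beta)
      mx_norm (row_restrict tau A *m x - row_restrict tau b) ^+ 2).

Lemma gram_unit (R : realType) (r n : nat) (B : 'M[R]_(r, n)) :
  row_free B -> B *m B^T \in unitmx.
Proof.
move=> Bfree; rewrite -row_free_unit; apply/row_freeP.
have inj (u : 'rV[R]_r) : u *m (B *m B^T) = 0 -> u = 0.
  move=> uBB; have : (u *m B) *m (u *m B)^T = 0.
    by rewrite trmx_mul mulmxA -(mulmxA u) uBB mul0mx.
  move=> /matrixP/(_ 0 0); rewrite !mxE.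
  under eq_bigr do rewrite [X in _ * X]mxE -expr2.
  move/eqP; rewrite psumr_eq0; last by move=> i _; exact: sqr_ge0.
  move=> /allP uB0; have uB : u *m B = 0.
    apply/rowP => j; rewrite [RHS]mxE; apply/eqP.
    by have := uB0 j (mem_index_enum j); rewrite /= sqrf_eq0.
  by apply: (row_free_inj Bfree); rewrite uB mul0mx.
apply/row_freeP; rewrite -kermx_eq0; apply/eqP/row_matrixP => i.
by rewrite row0; apply: inj; rewrite -row_mul mulmx_ker row0.
Qed.

Lemma is_pinv_uniq (R : realType) (m n : nat) (A : 'M[R]_(m, n))
    (X Y : 'M[R]_(n, m)) : is_pinv A X -> is_pinv A Y -> X = Y.
Proof.
move=> [AXA XAX sAX sXA] [AYA YAY sAY sYA].
have E1 : A *m X = A *m Y.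
  rewrite -sAX -{1}AYA -mulmxA trmx_mul -/(_ *m _) sAX.
  by rewrite -(mulmxA A) in AXA *; rewrite sAY !mulmxA -(mulmxA A) AXA.
have E2 : X *m A = Y *m A.
  rewrite -sYA -{2}AXA !mulmxA -mulmxA trmx_mul sXA sYA.
  by rewrite -!mulmxA (mulmxA A Y) AYA.
by rewrite -XAX -mulmxA E1 mulmxA E2 YAY.
Qed.

Lemma is_pinv_factor (R : realType) (m r n : nat) (C : 'M[R]_(m, r))
    (B : 'M[R]_(r, n)) :
  C^T *m C \in unitmx -> B *m B^T \in unitmx ->
  is_pinv (C *m B) (B^T *m invmx (B *m B^T) *m (invmx (C^T *m C) *m C^T)).
Proof.
move=> UC UB; set iB := invmx _; set iC := invmx _.
have siB : iB^T = iB by rewrite trmx_inv trmx_mul trmxK.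
have siC : iC^T = iC by rewrite trmx_inv trmx_mul trmxK.
have AX : C *m B *m (B^T *m iB *m (iC *m C^T)) = C *m iC *m C^T.
  by rewrite !mulmxA -(mulmxA C B) -(mulmxA C (B *m _)) mulmxV // mulmx1.
have XA : B^T *m iB *m (iC *m C^T) *m (C *m B) = B^T *m iB *m B.
  by rewrite !mulmxA -(mulmxA _ C^T C) -(mulmxA _ iC) mulVmx // mulmx1.
split.
- by rewrite AX !mulmxA -(mulmxA _ C^T C) -(mulmxA C iC) mulVmx // mulmx1.
- by rewrite XA !mulmxA -(mulmxA _ B B^T) -(mulmxA _ (B *m _)) mulmxV // mulmx1.
- by rewrite AX !trmx_mul trmxK siC mulmxA.
- by rewrite XA !trmx_mul trmxK siB mulmxA.
Qed.

Lemma pinvP (R : realType) (m n : nat) (A : 'M[R]_(m, n)) : is_pinv A (pinv A).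
Proof.
suff [X AX] : exists X, is_pinv A X by apply: (xgetI 0 AX).
have UC : (col_base A)^T *m col_base A \in unitmx.
  rewrite -{2}(trmxK (col_base A)); apply: gram_unit.
  by rewrite /row_free mxrank_tr -/(row_full _) col_base_full.
have := is_pinv_factor UC (gram_unit (row_base_free A)).
by rewrite mulmx_base => AX; eexists; exact: AX.
Qed.

(* Main.v *)
From mathcomp Require Import all_boot all_order all_algebra.
From mathcomp Require Import boolp classical_sets functions reals.
From mathcomp Require Import topology normedtype matrix_normedtype derive.
From mathcomp Require Import ring lra.
Require Import Defs.

(* A step through row i of unit norm decreases |x - x*|^2 by exactly the squared
   residual (a_i^T x - b_i)^2, which for the greedy choice in tau is
   |A_tau x - b_tau|_oo^2. Every row lies in C(m-1, beta-1) samples, so averaging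
   over tau gives beta |A x - b|^2 / (gamma m). All errors stay in range A^T,
   where |A v|^2 >= sigma_min^2 |v|^2: the minimum of |A v|^2 over the unit
   sphere of range A^T is a positive eigenvalue of A^T A. *)

Set Implicit Arguments.
Unset Strict Implicit.
Unset Printing Implicit Defensive.

Import Order.TTheory GRing.Theory Num.Theory.
Import numFieldNormedType.Exports.
Local Open Scope ring_scope.

(** * Squared Euclidean norms and their continuity *)

Lemma norm2_sqr (R : realType) (p : nat) (v : 'cV[R]_p) :
  norm2 v ^+ 2 = \sum_i v i 0 ^+ 2.
Proof. by rewrite sqr_sqrtr// sumr_ge0// => i _; exact: sqr_ge0. Qed.

Lemma norm2_sqrE (R : realType) (p : nat) (v : 'cV[R]_p) :
  norm2 v ^+ 2 = (v^T *m v) 0 0.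
Proof. by rewrite norm2_sqr mxE; apply: eq_bigr => i _; rewrite mxE expr2. Qed.

Lemma norm2_sqr_eq0 (R : realType) (p : nat) (v : 'cV[R]_p) :
  (norm2 v ^+ 2 == 0) = (v == 0).
Proof.
apply/eqP/eqP => [|->]; last first.
  by rewrite norm2_sqrE mulmx0 mxE.
rewrite norm2_sqr => /eqP; rewrite psumr_eq0 => [/allP v0|i _]; last exact: sqr_ge0.
apply/colP => i; rewrite [RHS]mxE; apply/eqP.
by rewrite -sqrf_eq0; exact: v0 (mem_index_enum i).
Qed.

Lemma norm2_sqrD (R : realType) (p : nat) (v w : 'cV[R]_p) (s : R) :
  norm2 (v + s *: w) ^+ 2
  = norm2 v ^+ 2 + s * (w^T *m v) 0 0 *+ 2 + s ^+ 2 * norm2 w ^+ 2.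
Proof.
rewrite !norm2_sqr mxE mulr_sumr -sumrMnl mulr_sumr -!big_split/=.
by apply: eq_bigr => i _; rewrite !mxE; ring.
Qed.

Lemma norm2_sqrZ (R : realType) (p : nat) (v : 'cV[R]_p) (s : R) :
  norm2 (s *: v) ^+ 2 = s ^+ 2 * norm2 v ^+ 2.
Proof.
by rewrite !norm2_sqr mulr_sumr; apply: eq_bigr => i _; rewrite mxE exprMn.
Qed.

(** Serves the compactness and extreme value arguments below, which are carried out on row vectors;
    hence the transpose. *)
Lemma norm2_mulmx_continuous (R : realType) (m n : nat) (M : 'M[R]_(m, n)) :
  continuous (fun u : 'rV[R]_n => norm2 (M *m u^T) ^+ 2).
Proof.
have -> : (fun u : 'rV[R]_n => norm2 (M *m u^T) ^+ 2)
  = \sum_i (fun u => (\sum_j M i j * u 0 j) ^+ 2).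
  apply/funext => u; rewrite norm2_sqr fct_sumE; apply: eq_bigr => i _.
  by rewrite mxE; under eq_bigr do rewrite mxE.
elim/big_ind : _ => [|f g cf cg u|i _].
- exact: cst_continuous.
- by apply: continuousD; [exact: cf|exact: cg].
have cs : continuous (fun u : 'rV[R]_n => \sum_j M i j * u 0 j).
  rewrite (_ : (fun _ => _) = \sum_j (fun u : 'rV[R]_n => M i j * u 0 j));
    last by apply/funext => u; rewrite fct_sumE.
  elim/big_ind : _ => [|f g cf cg u|j _ u].
  - exact: cst_continuous.
  - by apply: continuousD; [exact: cf|exact: cg].
  - by apply: continuousM; [exact: cst_continuous|exact: coord_continuous].
by move=> u; apply: (@continuousM _ _ _ _ u); exact: cs.
Qed.

(** * The range of [A^T] and the smallest nonzero singular value *)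

(* [pinv A *m A] is the orthogonal projection onto [range A^T]. *)
Lemma pinv_mul_tr (R : realType) (m n : nat) (A : 'M[R]_(m, n)) :
  pinv A *m A *m A^T = A^T.
Proof.
have [AXA _ _ sXA] := pinvP A.
by rewrite -{1}sXA -trmx_mul mulmxA AXA.
Qed.

(** The quadratic attains its minimum 0 at [s = 0], so its derivative [2 a] there vanishes. *)
Lemma quadratic_ge0_slope (R : realFieldType) (a c : R) :
  0 <= c -> (forall s, 0 <= s * a *+ 2 + s ^+ 2 * c) -> a = 0.
Proof.
(* The minimizer [- a / c] fails for [c = 0]; dividing by [c + 1] instead still gives a negative
   multiple of [a ^+ 2]. *)
move=> c0 /(_ (- a / (c + 1))).
have -> : - a / (c + 1) * a *+ 2 + (- a / (c + 1)) ^+ 2 * c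
  = - (a ^+ 2 * ((c + 2) / (c + 1) ^+ 2)) by field; lra.
rewrite oppr_ge0 pmulr_lle0; last by apply: divr_gt0; [lra|apply: exprn_gt0; lra].
by rewrite real_exprn_even_le0 ?num_real//= => /eqP.
Qed.

(** On the fixed space of [pinv A *m A] the matrix [A] is injective, so the minimum is positive even
    when [A] is rank-deficient. *)
Lemma rayleigh_min (R : realType) (m n : nat) (A : 'M[R]_(m, n)) :
  A != 0 ->
  exists lam : R, [/\ 0 < lam, eigenvalue (A^T *m A) lam &
    forall v : 'cV[R]_n, pinv A *m A *m v = v ->
      lam * norm2 v ^+ 2 <= norm2 (A *m v) ^+ 2].
Proof.
move=> A0; set P := pinv A *m A.
have PA : P *m A^T = A^T by exact: pinv_mul_tr.
have [w w0 Pw] : exists2 w : 'cV[R]_n, w != 0 & P *m w = w.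
  have [i Ai] : exists i, row i A != 0.
    apply/existsP; apply: contraNT A0 => /existsPn Ai.
    by apply/eqP/row_matrixP => i; rewrite row0; apply/eqP; rewrite -[_ == _]negbK Ai.
  exists (row i A)^T; first by rewrite -trmx0 (inj_eq trmx_inj).
  by rewrite tr_row !colE mulmxA PA.
(* Both constraints fix the value of some [norm2 (M *m u^T) ^+ 2], so the set is closed by
   continuity. *)
pose sphere := [set u : 'rV[R]_n |
  norm2 ((P - 1%:M) *m u^T) ^+ 2 = 0 /\ norm2 (1%:M *m u^T) ^+ 2 = 1]%classic.
have sphereP (u : 'rV[R]_n) : sphere u <-> P *m u^T = u^T /\ norm2 u^T ^+ 2 = 1.
  rewrite /sphere /= mul1mx mulmxBl mul1mx; split=> -[Pu ->]; split=> //.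
    by apply/eqP; rewrite -subr_eq0 -norm2_sqr_eq0 Pu.
  by apply/eqP; rewrite norm2_sqr_eq0 subr_eq0 Pu.
have normalize (v : 'cV[R]_n) : P *m v = v -> v != 0 ->
    sphere ((norm2 v)^-1 *: v)^T.
  move=> Pv v0; apply/sphereP; rewrite trmxK; split.
    by rewrite -scalemxAr Pv.
  by rewrite norm2_sqrZ exprVn mulVf// norm2_sqr_eq0.
have sphere_compact : compact sphere.
  have cube : compact [set u : 'rV[R]_n | forall i, u ord0 i \in `[-1, 1]%R]%classic.
    apply: (@rV_compact R n (fun=> `[-1, 1]%classic)) => _.
    exact: segment_compact.
  apply: subclosed_compact cube _.
    rewrite (_ : sphere = (fun u : 'rV[R]_n => norm2 ((P - 1%:M) *m u^T) ^+ 2) @^-1`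
        [set x | x = 0] `&` (fun u : 'rV[R]_n => norm2 (1%:M *m u^T) ^+ 2) @^-1`
        [set x | x = 1])%classic //.
    apply: closedI; apply: preimage_closed; try exact: closed_eq;
      by move=> u _; exact: norm2_mulmx_continuous.
  move=> u /sphereP[_ u1] i; rewrite in_itv/= -ler_norml.
  rewrite -(@expr_le1 _ 2)// real_normK ?num_real// -u1 norm2_sqr.
  rewrite (bigD1 i)//= mxE lerDl.
  by apply: sumr_ge0 => j _; exact: sqr_ge0.
have [u uS umin] := EVT_min_rV (ex_intro _ _ (normalize _ Pw w0)) sphere_compact
  (continuous_subspaceT (norm2_mulmx_continuous (M := A))).
move: uS; rewrite inE => /sphereP[Pu u1].
set lam := norm2 (A *m u^T) ^+ 2 in umin.
have lam_le (v : 'cV[R]_n) : P *m v = v ->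
    lam * norm2 v ^+ 2 <= norm2 (A *m v) ^+ 2.
  move=> Pv; have [->|v0] := eqVneq v 0.
    by rewrite mulmx0 !norm2_sqrE !mulmx0 !mxE mulr0.
  have := umin _ (mem_set (normalize _ Pv v0)).
  rewrite trmxK -scalemxAr norm2_sqrZ exprVn mulrC ler_pdivlMr//.
  by rewrite lt_def norm2_sqr_eq0 v0 sqr_ge0.
exists lam; split => //.
  rewrite lt_def sqr_ge0 andbT norm2_sqr_eq0; apply/eqP => Au0.
  move: u1; rewrite -Pu /P -mulmxA Au0 mulmx0 => /eqP.
  by rewrite norm2_sqrE mulmx0 mxE eq_sym oner_eq0.
apply/eigenvalueP; exists u; last first.
  apply/eqP => u0; move: u1; rewrite u0 trmx0 => /eqP.
  by rewrite norm2_sqrE mulmx0 mxE eq_sym oner_eq0.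
(* Moving from the minimizer [u] along its residual [g] cannot decrease the
   form [|A v|^2 - lam |v|^2], whose derivative there is [2 |g|^2]. *)
pose g := A^T *m A *m u^T - lam *: u^T.
have Pg : P *m g = g.
  by rewrite mulmxBr !mulmxA PA -scalemxAr Pu.
(* The right-hand side is half the derivative of the form at [u] in direction [g]. *)
have gg : norm2 g ^+ 2 = ((A *m g)^T *m (A *m u^T)) 0 0 - lam * (g^T *m u^T) 0 0.
  rewrite norm2_sqrE {2}/g mulmxBr -scalemxAr trmx_mul !mulmxA.
  by rewrite [LHS]mxE [X in _ + X]mxE [X in - X]mxE.
suff g0 : g = 0.
  apply: trmx_inj; rewrite trmx_mul trmx_mul trmxK linearZ/=.
  by apply/eqP; rewrite -subr_eq0 -/g g0.
apply/eqP; rewrite -norm2_sqr_eq0; apply/eqP.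
set G := norm2 g ^+ 2 in gg *.
set q := norm2 (A *m g) ^+ 2 - lam * norm2 g ^+ 2.
have q0 : 0 <= q by rewrite subr_ge0; exact: lam_le.
have pert s : 0 <= s * G *+ 2 + s ^+ 2 * q.
  (* The constant terms cancel, since [u] has norm 1 and [lam] is the value of |A v|^2 at [u]. *)
  have := lam_le (u^T + s *: g).
  rewrite mulmxDr -scalemxAr Pg Pu => /(_ erefl).
  rewrite mulmxDr -scalemxAr !norm2_sqrD u1 -/lam gg /q -/G.
  set x := (_ *m (A *m _)) 0 0; set y := (_ *m _) 0 0; lra.
exact: quadratic_ge0_slope pert.
Qed.

(** [Num.sqrt lam] is a nonzero singular value, so the infimum lies below it; attainment of the
    infimum never enters. *)
Lemma sigma_min_le (R : realType) (m n : nat) (A : 'M[R]_(m, n)) (v : 'cV[R]_n) :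
  A != 0 -> pinv A *m A *m v = v ->
  sigma_min A ^+ 2 * norm2 v ^+ 2 <= norm2 (A *m v) ^+ 2.
Proof.
move=> A0 Pv; have [lam [lam0 eig lam_le]] := rayleigh_min A0.
apply: le_trans (lam_le v Pv); apply: ler_wpM2r; first exact: sqr_ge0.
have sv : [set s | singular_value A s /\ s != 0]%classic (Num.sqrt lam).
  split; last by rewrite sqrtr_eq0 -ltNge.
  by split; rewrite ?sqrtr_ge0// sqr_sqrtr// ltW.
have lb0 : lbound [set s | singular_value A s /\ s != 0]%classic 0.
  by move=> s [[]].
(* Comparing squares requires the infimum to be nonnegative, which follows from the lower bound 0 on
   a nonempty set. *)
rewrite -[leRHS](sqr_sqrtr (ltW lam0)) lerXn2r ?nnegrE ?sqrtr_ge0//.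
  by apply: lb_le_inf => //; exists (Num.sqrt lam).
by apply: ge_inf => //; exists 0.
Qed.

(** * Counting samples and averaging residuals over them *)

Lemma card_samples (m beta : nat) : #|samples m beta| = 'C(m, beta).
Proof. by rewrite card_draws card_ord. Qed.

(** The samples avoiding [i] are the [beta]-subsets of the other [m - 1] indices; Pascal's rule
    gives the rest. *)
Lemma card_samples_mem (m beta : nat) (i : 'I_m) : (0 < beta)%N ->
  #|[set tau in samples m beta | i \in tau]| = 'C(m.-1, beta.-1).
Proof.
case: m i => [[]//|m] i; case: beta => // beta _.
have := cardsID [set tau : {set 'I_m.+1} | i \in tau] (samples m.+1 beta.+1).
have -> : samples m.+1 beta.+1 :\: [set tau : {set 'I_m.+1} | i \in tau]
    = [set tau : {set 'I_m.+1} | tau \subset [set~ i] & #|tau| == beta.+1].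
  by apply/setP => tau; rewrite !inE finset.subsetC finset.sub1set inE.
rewrite cards_draws cardsC1 card_ord card_samples binS addnC => /addnI <-.
by congr #|pred_of_set _|; apply/setP => tau; rewrite !inE.
Qed.

Lemma sum_samples (R : realType) (m beta : nat) (f : 'I_m -> R) :
  (0 < beta)%N ->
  \sum_(tau in samples m beta) \sum_(i in tau) f i
  = 'C(m.-1, beta.-1)%:R * \sum_i f i.
Proof.
move=> beta0; rewrite (exchange_big_dep predT)//= mulr_sumr.
apply: eq_bigr => i _; rewrite sumr_const -(card_samples_mem i beta0) mulr_natl.
by congr (_ *+ _); apply: eq_card => tau; rewrite !inE unfold_in inE.
Qed.

Lemma row_restrict_residual (R : realType) (m n : nat) (tau : {set 'I_m})
    (A : 'M[R]_(m, n)) (b : 'cV[R]_m) (x : 'cV[R]_n) :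
  row_restrict tau A *m x - row_restrict tau b = row_restrict tau (A *m x - b).
Proof. by apply/colP => i; rewrite !mxE; under eq_bigr do rewrite !mxE. Qed.

Lemma norm2_row_restrict (R : realType) (m : nat) (tau : {set 'I_m})
    (r : 'cV[R]_m) :
  norm2 (row_restrict tau r) ^+ 2 = \sum_(i in tau) r i 0 ^+ 2.
Proof.
by rewrite norm2_sqr [RHS]big_enum_val; apply: eq_bigr => i _; rewrite mxE.
Qed.

Lemma mx_norm_row_restrict (R : realType) (m : nat) (tau : {set 'I_m})
    (r : 'cV[R]_m) (i : 'I_m) :
  i \in tau -> (forall j, j \in tau -> `|r j 0| <= `|r i 0|) ->
  mx_norm (row_restrict tau r) = `|r i 0|.
Proof.
move=> itau imax; rewrite mx_normrE; apply/eqP; rewrite eq_le; apply/andP; split.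
  by apply/bigmax_leP; split=> // -[j k] _ /=; rewrite !ord1 mxE imax// enum_valP.
rewrite -[i](enum_rankK_in itau itau).
have := le_bigmax_cond 0 (fun ij : _ * 'I_1 => `|row_restrict tau r ij.1 ij.2|)
  (j := (enum_rank_in itau i, 0)) (P := predT) isT.
by rewrite /= mxE.
Qed.

Lemma norm2_row_restrict_le (R : realType) (m : nat) (tau : {set 'I_m})
    (r : 'cV[R]_m) :
  norm2 (row_restrict tau r) ^+ 2 <= #|tau|%:R * mx_norm (row_restrict tau r) ^+ 2.
Proof.
rewrite norm2_sqr -[in #|_|%:R](card_ord #|tau|) mulr_natl -sumr_const.
apply: ler_sum => i _; rewrite -[leLHS]real_normK ?num_real//.
rewrite lerXn2r ?nnegrE// ?mx_normrE; first exact: bigmax_ge_id.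
exact: (le_bigmax_cond 0 (fun ij : _ * 'I_1 => `|row_restrict tau r ij.1 ij.2|)
  (j := (i, 0)) (P := predT) isT).
Qed.

Lemma sum_norm2_samples (R : realType) (m beta : nat) (r : 'cV[R]_m) :
  (0 < beta)%N ->
  \sum_(tau in samples m beta) norm2 (row_restrict tau r) ^+ 2
  = 'C(m.-1, beta.-1)%:R * norm2 r ^+ 2.
Proof.
move=> beta0; rewrite norm2_sqr -sum_samples//.
by apply: eq_bigr => tau _; rewrite norm2_row_restrict.
Qed.

Lemma bin_beta_ratio (R : realType) (m beta : nat) : (0 < beta <= m)%N ->
  m%:R * 'C(m.-1, beta.-1)%:R = beta%:R * 'C(m, beta)%:R :> R.
Proof. by case: beta => // beta _; rewrite -!natrM mul_bin_diag. Qed.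

(** For [r != 0] this says that the dynamic range is at most [beta]. Being free of that quotient, it
    also covers [r = 0] and yields a uniform contraction factor. *)
Lemma mean_mx_norm_ge (R : realType) (m beta : nat) (r : 'cV[R]_m) :
  (0 < beta <= m)%N ->
  norm2 r ^+ 2 / m%:R
  <= mean (samples m beta) (fun tau => mx_norm (row_restrict tau r) ^+ 2).
Proof.
move=> /[dup] /andP[beta0 betam] beta_range.
have m0 : (0 < m)%N by exact: leq_trans betam.
have N0 : (0 < 'C(m, beta))%N by rewrite bin_gt0.
rewrite /mean card_samples ler_pdivrMr ?ltr0n// mulrAC ler_pdivlMr ?ltr0n//.
(* The factor [beta] turns ['C(m, beta)] into [m * 'C(m.-1, beta.-1)], the multiplicity of the rows
   in the samples times [m]. *)
rewrite -(@ler_pM2l _ beta%:R) ?ltr0n//.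
have -> : beta%:R * (norm2 r ^+ 2 * 'C(m, beta)%:R)
    = m%:R * \sum_(tau in samples m beta) norm2 (row_restrict tau r) ^+ 2.
  by rewrite sum_norm2_samples// [RHS]mulrA bin_beta_ratio//; ring.
rewrite mulrA [leRHS]mulrC ler_pM2l ?ltr0n// mulr_sumr.
apply: ler_sum => tau; rewrite inE => /eqP <-; exact: norm2_row_restrict_le.
Qed.

(** With D the sum of squared max norms, the dynamic range is ['C(m.-1, beta.-1)] |A x - b|^2 / D
    and the mean is D / ['C(m, beta)]; [bin_beta_ratio] relates the two binomials. *)
Lemma mean_mx_norm_dyn_range (R : realType) (m n beta : nat) (A : 'M[R]_(m, n))
    (b : 'cV[R]_m) (x : 'cV[R]_n) :
  (0 < beta <= m)%N -> A *m x != b ->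
  mean (samples m beta)
    (fun tau => mx_norm (row_restrict tau (A *m x - b)) ^+ 2)
  = beta%:R / (dyn_range beta A b x * m%:R) * norm2 (A *m x - b) ^+ 2.
Proof.
move=> /[dup] /andP[beta0 betam] beta_range Axb.
have m0 : (0 < m)%N by exact: leq_trans betam.
have C0 : (0 < 'C(m.-1, beta.-1))%N.
  by rewrite bin_gt0 -ltnS !prednK.
have N0 : (0 < 'C(m, beta))%N by rewrite bin_gt0.
have r0 : norm2 (A *m x - b) ^+ 2 != 0 by rewrite norm2_sqr_eq0 subr_eq0.
have -> : dyn_range beta A b x
    = 'C(m.-1, beta.-1)%:R * norm2 (A *m x - b) ^+ 2
      / \sum_(tau in samples m beta) mx_norm (row_restrict tau (A *m x - b)) ^+ 2.
  rewrite /dyn_range -sum_norm2_samples//.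
  by congr (_ / _); apply: eq_bigr => tau _; rewrite row_restrict_residual.
rewrite /mean card_samples.
have := bin_beta_ratio R beta_range.
have := mean_mx_norm_ge (A *m x - b) beta_range.
rewrite /mean card_samples.
set D := \sum_(_ in _) _; set C := 'C(m.-1, _)%:R; set N := 'C(_, _)%:R.
set r2 := _ ^+ 2 in r0 * => Dge CN.
(* The denominator of the dynamic range is nonzero because its mean dominates a positive multiple of
   the squared residual. *)
have D0 : D != 0.
  apply: contraTneq Dge => ->; rewrite mul0r -ltNge divr_gt0 ?ltr0n//.
  by rewrite lt_def r0 sqr_ge0.
have {}C0 : C != 0 by rewrite pnatr_eq0 -lt0n.
have {}N0 : N != 0 by rewrite pnatr_eq0 -lt0n.
have {}m0 : m%:R != 0 :> R by rewrite pnatr_eq0 -lt0n.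
have -> : beta%:R / (C * r2 / D * m%:R) * r2 = D * (beta%:R / (m%:R * C)).
  by field; rewrite r0 m0 D0 C0.
rewrite CN; have b0 : beta%:R != 0 :> R by rewrite pnatr_eq0 -lt0n.
by field; rewrite N0 b0.
Qed.

(** * One SKM step *)

(** Pythagoras: the step projects [x] orthogonally onto the hyperplane of equation [i], which
    contains [xs]. *)
Lemma skm_step_err (R : realType) (m n : nat) (A : 'M[R]_(m, n))
    (b : 'cV[R]_m) (x xs : 'cV[R]_n) (i : 'I_m) :
  norm2 (row i A)^T = 1 -> A *m xs = b ->
  norm2 (x - ((A *m x - b) i 0 / norm2 (row i A)^T ^+ 2) *: (row i A)^T - xs) ^+ 2
  = norm2 (x - xs) ^+ 2 - (A *m x - b) i 0 ^+ 2.
Proof.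
move=> a1 Axs; rewrite a1 expr1n divr1 addrAC -scaleNr norm2_sqrD a1.
rewrite trmxK -row_mul mulmxBr Axs [row _ _ _ _]mxE; ring.
Qed.

(** Each step adds a multiple of a column of [A^T], which the projection fixes. *)
Lemma skm_proj (R : realType) (m n : nat) (A : 'M[R]_(m, n)) (b : 'cV[R]_m)
    (x0 : 'cV[R]_n) (t : {set 'I_m} -> seq {set 'I_m} -> 'I_m)
    (h : seq {set 'I_m}) :
  pinv A *m A *m x0 = x0 ->
  pinv A *m A *m skm A b x0 t h = skm A b x0 t h.
Proof.
move=> Px0; elim: h => //= tau h IH; rewrite mulmxBr IH -scalemxAr.
by rewrite tr_row colE mulmxA pinv_mul_tr.
Qed.

(** * Averages over samples and histories *)

Lemma ler_mean (R : realType) (T : finType) (S : {set T}) (f g : T -> R) :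
  (forall s, s \in S -> f s <= g s) -> mean S f <= mean S g.
Proof. by move=> fg; apply: ler_wpM2r (ler_sum _ fg); rewrite invr_ge0. Qed.

Lemma eq_mean (R : realType) (T : finType) (S : {set T}) (f g : T -> R) :
  (forall s, s \in S -> f s = g s) -> mean S f = mean S g.
Proof. by move=> fg; congr (_ / _); apply: eq_bigr. Qed.

Lemma mean_ge0 (R : realType) (T : finType) (S : {set T}) (f : T -> R) :
  (forall s, s \in S -> 0 <= f s) -> 0 <= mean S f.
Proof. by move=> f0; rewrite divr_ge0// sumr_ge0. Qed.

Lemma meanZ (R : realType) (T : finType) (S : {set T}) (f : T -> R) (c : R) :
  mean S (fun s => c * f s) = c * mean S f.
Proof. by rewrite /mean -mulr_sumr mulrA. Qed.

Lemma mean_le0_eq0 (R : realType) (T : finType) (S : {set T}) (f : T -> R) :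
  (forall s, s \in S -> 0 <= f s) -> mean S f <= 0 ->
  forall s, s \in S -> f s = 0.
Proof.
move=> f0 mf s sS; have S0 : 0 < #|S|%:R :> R.
  by rewrite ltr0n card_gt0; apply/set0Pn; exists s.
move: mf; rewrite ler_pdivrMr// mul0r => sf.
apply/eqP; rewrite eq_le f0// andbT (le_trans _ sf)// (bigD1 s)//= lerDl.
by apply: sumr_ge0 => u /andP[uS _]; exact: f0.
Qed.

(** Conditional expectation of [f] after one further sample, given the history [h]; its [k]-th
    iterate accounts for [k] further samples. *)
Definition next_mean (R : realType) (T : finType) (S : {set T})
    (f : seq T -> R) (h : seq T) : R :=
  mean S (fun s => f (s :: h)).

Lemma sum_historiesS (R : realType) (m beta k : nat) (f : seq {set 'I_m} -> R) :
  \sum_(h in histories m beta k.+1) f h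
  = \sum_(h in histories m beta k) \sum_(tau in samples m beta) f (tau :: h).
Proof.
rewrite pair_big_dep/= (reindex (fun p : k.-tuple {set 'I_m} * {set 'I_m} =>
  [tuple of p.2 :: p.1]))/=; last first.
  exists (fun h : k.+1.-tuple _ => (behead_tuple h : k.-tuple _, thead h))
    => [[h tau] _|h _] /=.
    by rewrite theadE; congr pair; apply: val_inj.
  by rewrite [RHS]tuple_eta; apply: val_inj.
by apply: eq_bigl => -[h tau]; rewrite !inE /= andbC inE.
Qed.

(** The tower property: a uniform average over histories is an iterated conditional expectation. *)
Lemma mean_histories (R : realType) (m beta k : nat) (f : seq {set 'I_m} -> R) :
  mean (histories m beta k) (fun h => f h)
  = iter k (next_mean (samples m beta)) f [::].
Proof.
elim: k f => [|k IH] f.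
  rewrite /mean (_ : histories m beta 0 = [set [tuple]]).
    by rewrite big_set1 cards1 divr1.
  by apply/setP => h; rewrite !tuple0 !inE /=.
(* [iterSr] splits off the average over the newest sample, the head of the history. *)
rewrite iterSr -IH /next_mean /mean sum_historiesS -mulr_suml -mulrA.
congr (_ * _); rewrite -invfM; congr (_^-1).
(* Summing the constant 1 gives the recurrence for the number of histories. *)
rewrite -[LHS]sumr_const (sum_historiesS _ _ (fun=> 1)).
by under eq_bigr do rewrite sumr_const; rewrite sumr_const mulr_natr.
Qed.

(** * Bounds on iterated conditional expectations *)

Lemma iter_next_mean_geometric (R : realType) (T : finType) (S : {set T})
    (f : seq T -> R) (q : R) (k : nat) (h : seq T) :
  0 <= q -> all (mem S) h ->
  (forall h, all (mem S) h -> next_mean S f h <= q * f h) ->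
  iter k (next_mean S) f h <= q ^+ k * f h.
Proof.
move=> q0 + step; elim: k h => [|k IH] h hS; first by rewrite expr0 mul1r.
rewrite iterS exprSr -mulrA.
apply: le_trans (ler_wpM2l (exprn_ge0 k q0) (step h hS)).
rewrite -meanZ; apply: ler_mean => s sS; apply: IH; apply/andP; by split.
Qed.

(** Zero is absorbing for [f]; this handles histories that have reached the solution, where no rate
    is available. *)
Lemma iter_next_mean_eq0 (R : realType) (T : finType) (S : {set T})
    (f : seq T -> R) (k : nat) (h : seq T) :
  all (mem S) h -> f h = 0 ->
  (forall s h, s \in S -> all (mem S) h -> f h = 0 -> f (s :: h) = 0) ->
  iter k (next_mean S) f h = 0.
Proof.
move=> + + absorb; elim: k h => // k IH h hS fh0.
rewrite iterS /next_mean /mean big1 ?mul0r// => s sS.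
by apply: IH; [apply/andP; split|exact: absorb].
Qed.

Lemma past0 (T : Type) (h : seq T) : past h 0 = [::].
Proof. by rewrite /past subn0 drop_size. Qed.

Lemma past_rcons (T : Type) (h : seq T) (s : T) (j : nat) :
  past (rcons h s) j.+1 = rcons (past h j) s.
Proof.
rewrite /past size_rcons subSS drop_rcons// leq_subr//.
Qed.

(* Conditioning must proceed from the oldest sample on: the rate [rho] of a step
   is correlated with the error before that step, so the rates can only be
   extracted by bounding the product of the later ones uniformly. *)
Lemma iter_next_mean_prod (R : realType) (T : finType) (S : {set T})
    (f rho : seq T -> R) (good : pred (seq T)) (k : nat) (h : seq T) (C : R) :
  (forall h, 0 <= f h) ->
  (forall h, all (mem S) h -> good h = (f h != 0)) ->
  (forall s h, s \in S -> all (mem S) h -> f h = 0 -> f (s :: h) = 0) ->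
  (forall h, all (mem S) h -> good h -> next_mean S f h <= rho h * f h) ->
  all (mem S) h -> 0 <= C ->
  (forall g : k.-tuple T, all (mem S) g ->
     (forall j : 'I_k, good (past g j ++ h)) ->
     \prod_(j < k) rho (past g j ++ h) <= C) ->
  iter k (next_mean S) f h <= C * f h.
Proof.
move=> f0 goodE absorb step; elim: k h C => [|k IH] h C hS C0 prodC.
  have := prodC [tuple] isT; rewrite big_ord0 => C1 /=.
  by rewrite ler_peMl// C1// => -[].
have [fh0|fh0] := eqVneq (f h) 0.
  by rewrite fh0 mulr0 (iter_next_mean_eq0 _ hS fh0 absorb).
have gh : good h by rewrite goodE.
have fh_gt0 : 0 < f h by rewrite lt_def fh0 f0.
(* The sign of the rate comes from the step inequality itself, as [f h] is positive and the mean
   nonnegative. *)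
have rho0 : 0 <= rho h.
  rewrite -(pmulr_lge0 _ fh_gt0); apply: le_trans (step h hS gh).
  by apply: mean_ge0 => s _; exact: f0.
have consS s : s \in S -> all (mem S) (s :: h) by move=> sS; apply/andP; split.
(* A zero rate forces [f] to vanish at every successor; otherwise [C / rho h] bounds the product of
   the later rates. *)
rewrite iterS; have [r0|r0] := eqVneq (rho h) 0.
  have fs0 : forall s, s \in S -> f (s :: h) = 0.
    by apply: mean_le0_eq0 => //; rewrite -(mul0r (f h)) -r0; exact: step.
  rewrite /next_mean /mean big1 ?mul0r ?mulr_ge0// => s sS.
  by apply: (iter_next_mean_eq0 _ _ (fs0 s sS) absorb); exact: consS.
have r_gt0 : 0 < rho h by rewrite lt_def r0.
have -> : C * f h = C / rho h * (rho h * f h) by field.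
apply: le_trans (ler_wpM2l (divr_ge0 C0 rho0) (step h hS gh)).
rewrite -meanZ; apply: ler_mean => s sS; apply: IH.
- exact: consS.
- exact: divr_ge0.
move=> g gS ggood; rewrite ler_pdivlMr// mulrC.
(* The sample [s] is older than those of [g], so it goes at the end; the factor of index 0 is then
   [rho h]. *)
have := prodC [tuple of rcons g s]; rewrite all_rcons gS andbT => /(_ sS).
rewrite big_ord_recl past0 /=.
under eq_bigr do rewrite /bump/= add1n past_rcons cat_rcons.
apply=> -[[|j] jk] /=; first by rewrite past0.
by rewrite past_rcons cat_rcons; exact: (ggood (Ordinal (jk : (j < k)%N))).
Qed.

(** * Convergence of SKM in expectation *)

Theorem corollary1 (R : realType) (m n beta : nat) (A : 'M[R]_(m, n))
    (b : 'cV[R]_m) (x0 : 'cV[R]_n)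
    (t : {set 'I_m} -> seq {set 'I_m} -> 'I_m)
    (m_gt_n : (n < m)%N)
    (beta_range : (1 <= beta <= m)%N)
    (A_normalized : forall i : 'I_m, norm2 (row i A)^T = 1)
    (consistent : exists x : 'cV[R]_n, A *m x = b)
    (x0_range : exists z : 'cV[R]_m, x0 = A^T *m z)
    (t_greedy : skm_selection beta A b x0 t) :
  let xstar := pinv A *m b in
  let x (h : seq {set 'I_m}) := skm A b x0 t h in
  let err (h : seq {set 'I_m}) := norm2 (x h - xstar) ^+ 2 in
  let gamma (h : seq {set 'I_m}) := dyn_range beta A b (x h) in
  let rate (g : R) := 1 - beta%:R * sigma_min A ^+ 2 / (g * m%:R) in
  [/\ (* at least linear convergence in expectation *)
      exists q : R, 0 <= q < 1 /\
        forall k : nat,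
          mean (histories m beta k) (fun h => err h)
            <= q ^+ k * norm2 (x0 - xstar) ^+ 2,
      (* the k.+1-th iteration, conditionally on the first k samples *)
      forall (k : nat) (h : k.-tuple {set 'I_m}),
        h \in histories m beta k -> A *m x h != b ->
        mean (samples m beta) (fun tau => err (tau :: h))
          <= rate (gamma h) * err h
    & (* k iterations; the dynamic ranges depend on the samples, so the bound is
         the largest value of the product over the realizations along which
         they are all meaningful *)
      forall k : nat,
        mean (histories m beta k) (fun h => err h)
          <= (\big[Num.max/0]_(h in histories m beta k
                 | [forall j : 'I_k, A *m x (past h j) != b])
                \prod_(j < k) rate (gamma (past h j)))
             * norm2 (x0 - xstar) ^+ 2].
Proof.
move=> xstar x err gamma rate.
have /andP[beta0 betam] := beta_range.
have m0 : (0 < m)%N by exact: leq_trans betam.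
have A0 : A != 0.
  apply/eqP => A0; have := A_normalized (Ordinal m0).
  rewrite A0 row0 trmx0 => /(congr1 (fun z => z ^+ 2)).
  by rewrite norm2_sqrE mulmx0 mxE expr1n => /eqP; rewrite eq_sym oner_eq0.
have [AXA XAX _ _] := pinvP A.
have Axs : A *m xstar = b.
  by have [y Ay] := consistent; rewrite /xstar -Ay !mulmxA AXA.
have Px0 : pinv A *m A *m x0 = x0.
  by have [z ->] := x0_range; rewrite mulmxA pinv_mul_tr.
have Pe h : pinv A *m A *m (x h - xstar) = x h - xstar.
  by rewrite mulmxBr skm_proj// /xstar mulmxA XAX.
have Ae h : A *m (x h - xstar) = A *m x h - b by rewrite mulmxBr Axs.
(* The dynamic range is thus meaningful exactly when the error is nonzero. *)
have err0 h : (err h == 0) = (A *m x h == b).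
  rewrite /err norm2_sqr_eq0 -[in RHS]subr_eq0 -Ae; apply/eqP/eqP => [->|e0].
    by rewrite mulmx0.
  by rewrite -Pe -mulmxA e0 mulmx0.
have err_ge0 h : 0 <= err h by exact: sqr_ge0.
set S := samples m beta.
have errS tau h : tau \in S -> all (mem S) h ->
    err (tau :: h) = err h - mx_norm (row_restrict tau (A *m x h - b)) ^+ 2.
  move=> tauS hS; have [ttau tmax] := t_greedy tau h tauS hS.
  rewrite /err /x /= skm_step_err//; congr (_ - _).
  by rewrite (mx_norm_row_restrict ttau tmax) real_normK ?num_real.
have mean_err h : all (mem S) h -> next_mean S err h
    = err h - mean S (fun tau => mx_norm (row_restrict tau (A *m x h - b)) ^+ 2).
  move=> hS; rewrite /next_mean (eq_mean (fun tau tauS => errS tau h tauS hS)).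
  rewrite /mean sumrB mulrBl sumr_const -[_ *+ #|S|]mulr_natr mulfK//.
  by rewrite pnatr_eq0 -lt0n card_samples bin_gt0.
have absorb tau h : tau \in S -> all (mem S) h -> err h = 0 -> err (tau :: h) = 0.
  move=> tauS hS h0; apply/eqP; rewrite eq_le err_ge0 andbT errS// h0 sub0r oppr_le0.
  exact: sqr_ge0.
have rate_step h : all (mem S) h -> A *m x h != b ->
    next_mean S err h <= rate (gamma h) * err h.
  move=> hS Axb; rewrite mean_err// mean_mx_norm_dyn_range// /rate mulrBl mul1r.
  rewrite lerD2l lerN2 -/(gamma h) [_ * _ / _]mulrAC -[leLHS]mulrA.
  have c0 : 0 <= beta%:R / (gamma h * m%:R).
    by rewrite divr_ge0// mulr_ge0// divr_ge0// sumr_ge0// => tau _; exact: sqr_ge0.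
  apply: ler_wpM2l => //; rewrite -Ae; exact: sigma_min_le.
split.
- have [lam [lam0 _ lam_le]] := rayleigh_min A0.
  have m0R : 0 < m%:R :> R by rewrite ltr0n.
  (* This factor combines |A v|^2 >= lam |v|^2 with [mean_mx_norm_ge]; the maximum with 0 secures
     nonnegativity. *)
  exists (Num.max 0 (1 - lam / m%:R)); split.
    by rewrite le_max lexx/= gt_max ltr01 ltrBlDr ltrDl divr_gt0.
  move=> k; rewrite mean_histories; apply: iter_next_mean_geometric => //.
    by rewrite le_max lexx.
  move=> h hS; rewrite mean_err//.
  apply: (@le_trans _ _ ((1 - lam / m%:R) * err h)); last first.
    by apply: ler_wpM2r => //; rewrite le_max lexx orbT.
  rewrite mulrBl mul1r lerD2l lerN2.
  apply: le_trans (mean_mx_norm_ge _ beta_range).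
  by rewrite mulrAC ler_pM2r ?invr_gt0// -Ae lam_le.
- by move=> k h; rewrite inE => hS; exact: rate_step.
- move=> k; rewrite mean_histories.
  apply: (iter_next_mean_prod (rho := fun h => rate (gamma h))
    (good := fun h => A *m x h != b)) => // [h _||g gS ggood].
  + by rewrite err0.
  (* The default 0 keeps the bound nonnegative even if no realization qualifies. *)
  + exact: bigmax_ge_id.
  have -> : \prod_(j < k) rate (gamma (past g j ++ [::]))
      = \prod_(j < k) rate (gamma (past g j)).
    by apply: eq_bigr => j _; rewrite cats0.
  apply: (le_bigmax_cond 0 (fun g : k.-tuple {set 'I_m} =>
    \prod_(j < k) rate (gamma (past g j)))).
  rewrite inE gS; apply/forallP => j; by have := ggood j; rewrite cats0.
Qed.
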